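(* Infinite Hex, played from the empty board, is a draw: neither player has a winning strategy, and both players have drawing strategies.
   Context: Board: the infinite hexagonal lattice, arranged in horizontal rows. Tiles are indexed by $(a,b)\in\mathbb{Z}^2$, tile $(a,b)$ being centered at the point $(x,y)=(a+\tfrac{b}{2},\tfrac{\sqrt3}{2}b)$ of the plane; it is adjacent to the six tiles $(a\pm1,b)$, $(a,b\pm1)$, $(a+1,b-1)$, $(a-1,b+1)$. Play: two players, Red and Blue, alternately place one stone of their own color on an empty tile (stones are never moved or removed), for infinitely many moves (order type $\omega$). The outcome of a play is the resulting partial coloring of the tiles (tiles may remain empty). Standard winning condition: a red $\mathbb{Z}$-chain is a sequence $(h_n)_{n\in\mathbb{Z}}$ of red tiles with $h_n$ adjacent to $h_{n+1}$ for all $n$; similarly for blue. Red wins if there is a red $\mathbb{Z}$-chain converging to $(\infty,\infty)$ as $n\to+\infty$ (both coordinates $x,y$ of the tile centers tend to $+\infty$) and to $(-\infty,-\infty)$ as $n\to-\infty$. Blue wins if there is a blue $\mathbb{Z}$-chain converging to $(-\infty,\infty)$ at one end and to $(\infty,-\infty)$ at the other. A play in which neither player wins is a draw. Strategies: a strategy for a player tells that player which move to make at each turn as a function of the play so far. It is winning if that player wins every play in which they follow it; it is a drawing strategy if the opponent wins no play in which the player follows it (so it guarantees a draw or better). *)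

(* Defs.v *)
From Stdlib Require Import Reals ZArith List.
From Coquelicot Require Import Coquelicot.

Definition tile : Type := (Z * Z)%type.

Definition center_x (t : tile) : R := (IZR (fst t) + IZR (snd t) / 2)%R.
Definition center_y (t : tile) : R := (sqrt 3 / 2 * IZR (snd t))%R.

Definition adjacent (t u : tile) : Prop :=
  let (a, b) := t in
  (u = (a + 1, b) \/ u = (a - 1, b) \/
   u = (a, b + 1) \/ u = (a, b - 1) \/
   u = (a + 1, b - 1) \/ u = (a - 1, b + 1))%Z.

Inductive player : Type := Red | Blue.

Definition opponent (p : player) : player :=
  match p with Red => Blue | Blue => Red end.

(* Partial colorings are represented by their graph: [c t p] says that tile [t]
   has color [p], and a tile with no color is empty. *)
Definition coloring : Type := tile -> player -> Prop.

Definition Z_chain (c : coloring) (p : player) (h : Z -> tile) : Prop :=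
  forall n : Z, c (h n) p /\ adjacent (h n) (h (n + 1)%Z).

Definition tends_to (g : nat -> tile) (lx ly : Rbar) : Prop :=
  is_lim_seq (fun n => center_x (g n)) lx /\
  is_lim_seq (fun n => center_y (g n)) ly.

Definition forward_end (h : Z -> tile) : nat -> tile := fun n => h (Z.of_nat n).
Definition backward_end (h : Z -> tile) : nat -> tile :=
  fun n => h (- Z.of_nat n)%Z.

(* Adjacency is symmetric, so [fun n => h (- n)] is a chain whenever [h] is:
   which of Blue's two ends is the forward one is immaterial. *)
Definition wins (p : player) (c : coloring) : Prop :=
  match p with
  | Red => exists h, Z_chain c Red h /\
             tends_to (forward_end h) p_infty p_infty /\
             tends_to (backward_end h) m_infty m_infty
  | Blue => exists h, Z_chain c Blue h /\
             tends_to (forward_end h) m_infty p_infty /\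
             tends_to (backward_end h) p_infty m_infty
  end.

Definition mover (first : player) (n : nat) : player :=
  if Nat.even n then first else opponent first.

(* [m n] is the tile taken at move [n], counting both players' moves from 0. *)
Definition is_play (m : nat -> tile) : Prop :=
  forall i j : nat, (i < j)%nat -> m i <> m j.

Definition outcome (first : player) (m : nat -> tile) : coloring :=
  fun t p => exists n : nat, mover first n = p /\ m n = t.

Definition history (m : nat -> tile) (n : nat) : list tile := map m (seq 0 n).

(* The argument of a strategy lists the moves made so far, earliest first.
   Only its values at legal positions with [p] to move matter, and there it
   must choose an empty tile. *)
Definition is_strategy (first p : player) (s : list tile -> tile) : Prop :=
  forall l : list tile,
    NoDup l -> mover first (length l) = p -> ~ In (s l) l.

Definition follows (first p : player) (s : list tile -> tile)
    (m : nat -> tile) : Prop :=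
  forall n : nat, mover first n = p -> m n = s (history m n).

Definition winning_strategy (first p : player) (s : list tile -> tile) : Prop :=
  is_strategy first p s /\
  forall m : nat -> tile,
    is_play m -> follows first p s m -> wins p (outcome first m).

Definition drawing_strategy (first p : player) (s : list tile -> tile) : Prop :=
  is_strategy first p s /\
  forall m : nat -> tile,
    is_play m -> follows first p s m -> ~ wins (opponent p) (outcome first m).

(* Main.v *)
Require Import Defs.
From Stdlib Require Import Reals ZArith List Lia Lra Classical.
From Coquelicot Require Import Coquelicot.
Import ListNotations.
Local Open Scope Z_scope.

(** Both players have drawing strategies because the tiles can be paired so
    that a set containing at most one tile of each pair carries no winning
    chain of a given colour: the player who always answers a move with the
    partner of that tile keeps the opponent's tiles to such a set
    ([pairing_strategy_separates]). A winning strategy is then impossible, since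
    it could be played against a drawing strategy of the opponent.

    Against Red the pairing comes from the glide reflection
    [glide (a, b) = (a + b, 1 - b)], which exchanges the rows [b <= 0] with the
    rows [b >= 1]; a tile [t] of the lower half is paired with [glide t]. As
    [(a, 0)] is paired with [(a, 1)], Red can only cross from the lower half to
    the upper half by a step [(a, 0)] to [(a - 1, 1)].

    Suppose that a red chain [h] comes from the south-west and goes to the
    north-east. Let [C] be the set of the lower red tiles connected, through
    lower red tiles, to the south-western tail of [h], and let [h m] be the last
    tile of [h] in [C]. Then [h (m + 1)] is in the upper half, so
    [h m = (a, 0)] and [h (m + 1) = (a - 1, 1)]. A walk [A] in [C] from [h m] to
    the south-west, the edge from [(a, 0)] to [(a, 1)], and the walk [glide A]
    from [(a, 1)] to the north-west together form a barrier shaped like the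
    sign [>]. The tiles [h n] with [m < n] avoid it: they avoid [A] because
    [h m] was last, and [glide A] because of the pairing. They start just west
    of the tip, hence inside, but must end far to the east, hence outside: a
    contradiction ([glide_pairing_blocks]).

    Inside and outside are told apart by the signed number of crossings between
    the barrier and the horizontal ray that runs east from a tile
    ([barrier_flux]). It does not change along a chain disjoint from the barrier
    ([barrier_flux_move]); it is [-1] at [h (m + 1)], and it is [0] at a tile
    east of the whole barrier.

    The reflection [mirror] of the plane in the axis [x = 0] exchanges the two
    winning conditions, and turns this pairing into one against Blue. *)

(** * The hexagonal grid in coordinates *)

Lemma adjacent_coord (t u : tile) : adjacent t u <->
  (snd u = snd t /\ (fst u = fst t + 1 \/ fst u = fst t - 1)) \/
  (snd u = snd t + 1 /\ (fst u = fst t \/ fst u = fst t - 1)) \/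
  (snd u = snd t - 1 /\ (fst u = fst t \/ fst u = fst t + 1)).
Proof.
destruct t as [a b], u as [c d]; unfold adjacent, tile; cbn [fst snd].
rewrite !pair_equal_spec; lia.
Qed.

Lemma adjacent_sym (t u : tile) : adjacent t u -> adjacent u t.
Proof. rewrite !adjacent_coord; lia. Qed.

Lemma tile_neq (t u : tile) : t <> u -> fst t <> fst u \/ snd t <> snd u.
Proof.
destruct t as [a b], u as [c d]; simpl; intros H.
destruct (Z.eq_dec a c) as [->|]; [|now left].
destruct (Z.eq_dec b d) as [->|]; [now elim H|now right].
Qed.

Lemma tile_eq_dec (t u : tile) : {t = u} + {t <> u}.
Proof. decide equality; apply Z.eq_dec. Qed.

(** * Crossings of a walk with an eastward ray *)

Fixpoint walk (u : tile) (l : list tile) (v : tile) : Prop :=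
  match l with
  | [] => u = v
  | w :: l' => adjacent u w /\ walk w l' v
  end.

(** Indicator of the open eastward ray from [t] along its own row. *)
Definition east (t u : tile) : Z :=
  if ((snd u =? snd t) && (fst t <? fst u))%bool then 1 else 0.

Definition below (t u : tile) : Z := if snd u =? snd t - 1 then 1 else 0.

(** Signed crossing number of the step from [u] to [v] with a ray that starts
    at [t] and runs east just under the row of [t]: downward steps count [1] and
    upward steps [-1]. *)
Definition cross (t u v : tile) : Z := east t u * below t v - east t v * below t u.

Fixpoint flux (t u : tile) (l : list tile) : Z :=
  match l with
  | [] => 0
  | w :: l' => cross t u w + flux t w l'
  end.

Ltac rays :=
  repeat match goal with
  | |- context [?a =? ?b] => destruct (Z.eqb_spec a b); try (exfalso; lia)
  | |- context [?a <? ?b] => destruct (Z.ltb_spec a b); try (exfalso; lia)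
  end; simpl; try lia.

Lemma cross_move_right (t t' u v : tile) :
  snd t' = snd t -> fst t' = fst t + 1 -> t' <> u -> t' <> v ->
  cross t u v = cross t' u v.
Proof.
intros Hr Hc Hu%tile_neq Hv%tile_neq.
unfold cross, east, below; rewrite Hr, Hc in *; rays.
Qed.

(** The edges counted from [t] leave the half-row [east t] downwards, and those
    counted from [t'] enter it from above. Every other edge into or
    out of that half-row would have to use [t] or [t'], so the difference is the net flow of the step
    out of the half-row. *)
Lemma cross_move_up (t t' u v : tile) :
  snd t' = snd t + 1 -> fst t' = fst t \/ fst t' = fst t - 1 ->
  adjacent u v -> t <> u -> t <> v -> t' <> u -> t' <> v ->
  cross t u v - cross t' u v = east t u - east t v.
Proof.
intros Hr Hc Huv%adjacent_coord Hu%tile_neq Hv%tile_neq Hu'%tile_neq Hv'%tile_neq.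
unfold cross, east, below; rewrite Hr in *.
destruct Huv as [[E F]|[[E F]|[E F]]]; rewrite E in *;
  (destruct (Z.eq_dec (snd u) (snd t)) as [Eu|]; [rewrite Eu in *|]); rays.
Qed.

(** In all six directions the crossing number of a step changes by a
    coboundary, which therefore telescopes along a walk. The support of [phi] is
    confined to two rows so that the boundary terms vanish when the walk ends
    above or below these rows. *)
Lemma cross_move (t t' : tile) : adjacent t t' ->
  exists phi : tile -> Z,
    (forall u, snd u <> snd t -> snd u <> snd t' -> phi u = 0) /\
    (forall u v, adjacent u v -> t <> u -> t <> v -> t' <> u -> t' <> v ->
       cross t u v - cross t' u v = phi u - phi v).
Proof.
intros [[E [F|F]]|[[E F]|[E F]]]%adjacent_coord.
- exists (fun _ => 0); split; [reflexivity|intros u v _ _ _ Hu Hv].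
  rewrite (cross_move_right t t') by assumption; lia.
- exists (fun _ => 0); split; [reflexivity|intros u v _ Hu Hv _ _].
  rewrite (cross_move_right t' t) by (assumption || lia); lia.
- exists (east t); split.
  + intros u Hu _; unfold east; rays.
  + intros u v; now apply cross_move_up.
- exists (fun u => - east t' u); split.
  + intros u _ Hu; unfold east; rays.
  + intros u v Huv H1 H2 H3 H4.
    pose proof (cross_move_up t' t u v ltac:(lia) ltac:(lia) Huv H3 H4 H1 H2); lia.
Qed.

Lemma flux_move (t t' : tile) (phi : tile -> Z) :
  (forall u v, adjacent u v -> t <> u -> t <> v -> t' <> u -> t' <> v ->
     cross t u v - cross t' u v = phi u - phi v) ->
  forall (l : list tile) (u v : tile), walk u l v ->
    ~ In t (u :: l) -> ~ In t' (u :: l) ->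
    flux t u l - flux t' u l = phi u - phi v.
Proof.
intros Hphi l; induction l as [|w l IH]; intros u v; simpl.
- intros -> _ _; lia.
- intros [Huw Hw] Ht Ht'.
  assert (H1 : flux t w l - flux t' w l = phi w - phi v)
    by (apply IH; simpl; tauto).
  assert (H2 : cross t u w - cross t' u w = phi u - phi w)
    by (apply Hphi; intuition congruence).
  lia.
Qed.

(** A crossing step has one end on the ray and the other end in the row below,
    so no step crosses if either of the two is avoided. *)
Lemma flux_not_east (t : tile) (l : list tile) (u : tile) :
  (forall w, In w (u :: l) -> east t w = 0) -> flux t u l = 0.
Proof.
revert u; induction l as [|w l IH]; intros u H; [reflexivity|].
cbn [flux]; rewrite IH by (intros x Hx; apply H; now right).
unfold cross; rewrite (H u), (H w) by (simpl; tauto); lia.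
Qed.

Lemma flux_not_below (t : tile) (l : list tile) (u : tile) :
  (forall w, In w (u :: l) -> below t w = 0) -> flux t u l = 0.
Proof.
revert u; induction l as [|w l IH]; intros u H; [reflexivity|].
cbn [flux]; rewrite IH by (intros x Hx; apply H; now right).
unfold cross; rewrite (H u), (H w) by (simpl; tauto); lia.
Qed.

(** * The glide reflection and the barrier *)

(** Reflection in the axis [y = 0], which maps [(a, b)] to [(a + b, - b)],
    followed by the translation by [(0, 1)]. *)
Definition glide (t : tile) : tile := (fst t + snd t, 1 - snd t).

(** Inverse of [glide]; it differs from [glide] because a glide reflection is
    not an involution. *)
Definition unglide (t : tile) : tile := (fst t + snd t - 1, 1 - snd t).

Lemma glide_adjacent (t u : tile) : adjacent t u -> adjacent (glide t) (glide u).
Proof. rewrite !adjacent_coord; unfold glide; cbn [fst snd]; lia. Qed.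

Lemma glide_walk (l : list tile) : forall u v : tile,
  walk u l v -> walk (glide u) (map glide l) (glide v).
Proof.
induction l as [|w l IH]; simpl; intros u v.
- now intros ->.
- intros [H1 H2]; split; [now apply glide_adjacent|now apply IH].
Qed.

(** Crossings with the barrier made of the walk from [u] along [l], traversed
    backwards, then the edge from [u] to [glide u], then the image of the walk.
    Reversing a walk changes the sign of its flux, whence the subtraction. *)
Definition barrier_flux (t u : tile) (l : list tile) : Z :=
  flux t (glide u) (map glide l) + cross t u (glide u) - flux t u l.

(** The boundary terms of the three parts cancel at [u] and at [glide u]. Those
    at the two ends [v] and [glide v] of the barrier vanish, because these ends
    lie below and above the rows of [t] and [t']. *)
Lemma barrier_flux_move (t t' u v : tile) (l : list tile) :
  adjacent t t' -> walk u l v -> adjacent u (glide u) ->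
  (forall w, In w (u :: l) -> t <> w /\ t' <> w /\ t <> glide w /\ t' <> glide w) ->
  snd v < snd t < 1 - snd v -> snd v < snd t' < 1 - snd v ->
  barrier_flux t u l = barrier_flux t' u l.
Proof.
intros Htt' Hl Hu Hdisj Ht Ht'.
destruct (cross_move t t' Htt') as [phi [Hsupp Hphi]].
assert (Hg : forall x, (forall w, In w (u :: l) -> x <> glide w) ->
   ~ In x (glide u :: map glide l)).
{ intros x Hx Hin; change (In x (map glide (u :: l))) in Hin.
  apply in_map_iff in Hin; destruct Hin as [w [<- Hw]]; now apply (Hx w). }
pose proof (flux_move t t' phi Hphi l u v Hl
  ltac:(intros Hin; destruct (Hdisj _ Hin) as [? [? _]]; congruence)
  ltac:(intros Hin; destruct (Hdisj _ Hin) as [? [? _]]; congruence)) as E1.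
pose proof (flux_move t t' phi Hphi _ _ _ (glide_walk l u v Hl)
  ltac:(apply Hg; intros w Hw; apply (Hdisj w Hw))
  ltac:(apply Hg; intros w Hw; apply (Hdisj w Hw))) as E2.
destruct (Hdisj u ltac:(now left)) as [D1 [D2 [D3 D4]]].
pose proof (Hphi u (glide u) Hu D1 D3 D2 D4) as E3.
assert (phi v = 0) by (apply Hsupp; lia).
assert (phi (glide v) = 0) by (apply Hsupp; unfold glide; cbn [fst snd]; lia).
unfold barrier_flux; lia.
Qed.

(** * No red chain survives the pairing *)

(** Twice the horizontal coordinate of the centre, to stay in the integers. *)
Definition abscissa (t : tile) : Z := 2 * fst t + snd t.

Lemma bounded_on_interval (f : Z -> Z) (lo hi : Z) :
  exists B, forall n, lo <= n <= hi -> - B <= f n <= B.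
Proof.
assert (H : forall j : nat, exists B, forall n, lo <= n <= lo + Z.of_nat j -> - B <= f n <= B).
{ induction j as [|j [B HB]].
  - exists (Z.abs (f lo)); intros n Hn; replace n with lo by lia; lia.
  - exists (Z.max B (Z.abs (f (lo + Z.of_nat (S j))))); intros n Hn.
    destruct (Z.eq_dec n (lo + Z.of_nat (S j))) as [->|Hne]; [lia|].
    specialize (HB n ltac:(lia)); lia. }
destruct (H (Z.to_nat (hi - lo))) as [B HB].
exists B; intros n Hn; apply HB; lia.
Qed.

Lemma last_index (Q : Z -> Prop) (k K : Z) :
  Q k -> (forall n, K <= n -> ~ Q n) ->
  exists m, Q m /\ forall n, m < n -> ~ Q n.
Proof.
intros Hk HK.
assert (H : forall j : nat, (forall n, k + Z.of_nat j <= n -> ~ Q n) ->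
   exists m, Q m /\ forall n, m < n -> ~ Q n).
{ induction j as [|j IH]; intros Hj.
  - elim (Hj k); [lia|assumption].
  - destruct (classic (Q (k + Z.of_nat j))) as [Hq|Hq].
    + exists (k + Z.of_nat j); split; [assumption|intros n Hn; apply Hj; lia].
    + apply IH; intros n Hn.
      destruct (Z.eq_dec n (k + Z.of_nat j)) as [->|]; [assumption|apply Hj; lia]. }
apply (H (Z.to_nat (K - k))); intros n Hn; apply HK; lia.
Qed.

Section GlidePairing.

Variables (S : tile -> Prop) (h : Z -> tile).
Hypothesis h_in : forall n, S (h n).
Hypothesis h_adj : forall n, adjacent (h n) (h (n + 1)).
Hypothesis h_forward : forall B, exists N, forall n, N <= n ->
  B < abscissa (h n) /\ B < snd (h n).
Hypothesis h_backward : forall B, exists N, forall n, n <= N ->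
  abscissa (h n) < B /\ snd (h n) < B.
Hypothesis S_glide : forall t, snd t <= 0 -> S t -> ~ S (glide t).

(** The component is used, rather than the tail of [h] up to its first upper
    tile, because [h] may revisit tiles: after its last visit to the component
    [h] cannot touch the barrier, and it must leave upwards, since a lower red
    neighbour would still belong to the component. *)
Inductive lower_component : tile -> Prop :=
| lower_tail (k : Z) :
    (forall n, n <= k -> snd (h n) <= 0) -> lower_component (h k)
| lower_step (t u : tile) :
    lower_component t -> adjacent t u -> S u -> snd u <= 0 -> lower_component u.

Lemma lower_component_spec (t : tile) :
  lower_component t -> S t /\ snd t <= 0.
Proof.
destruct 1 as [k Hk|t u _ _ Hu Hr]; [|tauto].
split; [apply h_in|apply Hk; lia].
Qed.

Lemma tail_walk (k : Z) (j : nat) :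
  exists l, walk (h k) l (h (k - Z.of_nat j)) /\
    forall w, In w (h k :: l) -> exists n, n <= k /\ w = h n.
Proof.
revert k; induction j as [|j IH]; intros k.
- exists []; split; [simpl; f_equal; lia|].
  intros w [<-|[]]; exists k; split; [lia|reflexivity].
- destruct (IH (k - 1)) as [l [Hl Hin]]; exists (h (k - 1) :: l); split.
  + simpl; split.
    * apply adjacent_sym; replace k with (k - 1 + 1) at 2 by lia; apply h_adj.
    * replace (k - Z.pos (Pos.of_succ_nat j)) with (k - 1 - Z.of_nat j) by lia.
      exact Hl.
  + intros w [<-|Hw]; [exists k; split; [lia|reflexivity]|].
    destruct (Hin w Hw) as [n [Hn ->]]; exists n; split; [lia|reflexivity].
Qed.

(** The lower half of the barrier. The eastern bound [X] is chosen before the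
    depth [B]: the part of [h] followed until it is east of [X] determines how
    far down the barrier has to reach. *)
Lemma lower_component_walk (t : tile) : lower_component t ->
  exists X, forall B, exists l v, walk t l v /\ snd v < B /\
    forall w, In w (t :: l) -> lower_component w /\ abscissa w <= X.
Proof.
induction 1 as [k Hk|t u Ht [X IH] Htu Hu Hr].
- destruct (h_backward 0) as [N0 HN0].
  destruct (bounded_on_interval (fun n => abscissa (h n)) N0 k) as [X HX].
  exists (Z.max 0 X); intros B.
  destruct (h_backward B) as [N HN].
  destruct (tail_walk k (Z.to_nat (k - N))) as [l [Hl Hin]].
  exists l, (h (k - Z.of_nat (Z.to_nat (k - N)))); split; [exact Hl|split].
  + apply HN; lia.
  + intros w Hw; destruct (Hin w Hw) as [n [Hn ->]]; split.
    * apply lower_tail; intros i Hi; apply Hk; lia.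
    * destruct (Z.le_gt_cases n N0) as [Hle|Hgt].
      -- specialize (HN0 n Hle); lia.
      -- specialize (HX n ltac:(lia)); simpl in HX; lia.
- exists (Z.max X (abscissa u)); intros B.
  destruct (IH B) as [l [v [Hl [Hv Hin]]]].
  exists (t :: l), v; split; [|split; [exact Hv|]].
  + split; [now apply adjacent_sym|exact Hl].
  + intros w [<-|Hw].
    * split; [now apply lower_step with t|lia].
    * destruct (Hin w Hw); split; [assumption|lia].
Qed.

Lemma glide_pairing_blocks : False.
Proof.
destruct (h_backward 0) as [k0 Hk0].
destruct (h_forward 0) as [K HK].
destruct (last_index (fun n => lower_component (h n)) k0 K) as [m [Hm Hlast]].
{ apply lower_tail; intros n Hn; specialize (Hk0 n Hn); lia. }
{ intros n Hn Hc; apply lower_component_spec in Hc; specialize (HK n Hn); lia. }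
destruct (lower_component_spec _ Hm) as [_ Hrow].
assert (Hup : 1 <= snd (h (m + 1))).
{ destruct (Z.le_gt_cases (snd (h (m + 1))) 0) as [Hle|]; [|lia].
  elim (Hlast (m + 1)); [lia|].
  now apply lower_step with (h m). }
pose proof (proj1 (adjacent_coord _ _) (h_adj m)) as Hcase.
assert (Hm0 : snd (h m) = 0) by lia.
assert (Hm1 : snd (h (m + 1)) = 1) by lia.
(* The other upper neighbour of h m is its partner. *)
assert (Hleft : fst (h (m + 1)) = fst (h m) - 1).
{ assert (Hd : fst (h (m + 1)) = fst (h m) \/ fst (h (m + 1)) = fst (h m) - 1) by lia.
  destruct Hd as [Hd|]; [|assumption].
  elim (S_glide (h m) Hrow (h_in m)).
  replace (glide (h m)) with (h (m + 1)); [apply h_in|].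
  unfold glide; rewrite (surjective_pairing (h (m + 1))); f_equal; lia. }
destruct (lower_component_walk _ Hm) as [X HX].
destruct (h_forward (X + 1)) as [M0 HM0].
(* At index M the chain is east of the barrier. The image under glide is one
   half-unit further east than the walk, hence the bound X + 1. *)
pose (M := Z.max (m + 1) M0).
destruct (bounded_on_interval (fun n => snd (h n)) (m + 1) M) as [B HB].
destruct (HX (- B)) as [l [v [Hl [Hv Hin]]]].
assert (Hadj : adjacent (h m) (glide (h m))).
{ rewrite adjacent_coord; unfold glide; cbn [fst snd]; lia. }
assert (Hdisj : forall n, m < n -> forall w, In w (h m :: l) -> h n <> w /\ h n <> glide w).
{ intros n Hn w Hw; destruct (Hin w Hw) as [Hc _].
  destruct (lower_component_spec _ Hc) as [HS Hr]; split.
  - intros <-; now apply (Hlast n).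
  - intros E; apply (S_glide w Hr HS); rewrite <- E; apply h_in. }
assert (Hconst : forall j : nat, m + 1 + Z.of_nat j <= M ->
  barrier_flux (h (m + 1 + Z.of_nat j)) (h m) l = barrier_flux (h (m + 1)) (h m) l).
{ induction j as [|j IH]; intros Hj; [f_equal; f_equal; lia|].
  rewrite <- IH by lia; symmetry.
  replace (m + 1 + Z.of_nat (Datatypes.S j)) with (m + 1 + Z.of_nat j + 1) in * by lia.
  apply barrier_flux_move with v; try assumption.
  - apply h_adj.
  - intros w Hw.
    destruct (Hdisj (m + 1 + Z.of_nat j) ltac:(lia) w Hw).
    destruct (Hdisj (m + 1 + Z.of_nat j + 1) ltac:(lia) w Hw); tauto.
  - specialize (HB (m + 1 + Z.of_nat j) ltac:(lia)); simpl in HB; lia.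
  - specialize (HB (m + 1 + Z.of_nat j + 1) ltac:(lia)); simpl in HB; lia. }
specialize (Hconst (Z.to_nat (M - (m + 1))) ltac:(lia)).
replace (m + 1 + Z.of_nat (Z.to_nat (M - (m + 1)))) with M in Hconst by lia.
assert (Hlow : forall w, In w (h m :: l) -> snd w <= 0 /\ abscissa w <= X).
{ intros w Hw; destruct (Hin w Hw) as [Hc ?]; split; [|assumption].
  now apply lower_component_spec. }
assert (Hglide : forall x, In x (glide (h m) :: map glide l) ->
   exists w, x = glide w /\ In w (h m :: l)).
{ intros x Hx; change (In x (map glide (h m :: l))) in Hx.
  apply in_map_iff in Hx; destruct Hx as [w [<- Hw]]; now exists w. }
assert (Hstart : barrier_flux (h (m + 1)) (h m) l = -1).
{ unfold barrier_flux.
  rewrite flux_not_below.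
  2:{ intros x Hx; destruct (Hglide x Hx) as [w [-> Hw]].
      specialize (Hlow w Hw); unfold below, glide; cbn [fst snd]; rays. }
  rewrite flux_not_east.
  2:{ intros w Hw; specialize (Hlow w Hw); unfold east; rays. }
  unfold cross, east, below, glide; cbn [fst snd].
  rewrite Hm1, Hleft, Hm0; rays. }
assert (HM : X + 1 < abscissa (h M)) by (apply HM0; lia).
assert (Hend : barrier_flux (h M) (h m) l = 0).
{ assert (E : forall w, In w (h m :: l) -> east (h M) w = 0 /\ east (h M) (glide w) = 0).
  { intros w Hw; specialize (Hlow w Hw); unfold abscissa in *.
    unfold east, glide; cbn [fst snd]; split; rays. }
  unfold barrier_flux.
  rewrite flux_not_east.
  2:{ intros x Hx; destruct (Hglide x Hx) as [w [-> Hw]]; now apply E. }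
  rewrite flux_not_east by (intros w Hw; now apply E).
  unfold cross; destruct (E (h m) ltac:(now left)) as [-> ->]; lia. }
lia.
Qed.

End GlidePairing.

(** * From limits of centres to integer bounds *)

Lemma tends_to_p_infty_Z (c : R) (f : nat -> Z) :
  (0 < c)%R -> is_lim_seq (fun n => c * IZR (f n))%R p_infty ->
  forall B, exists N, forall n, (N <= n)%nat -> B < f n.
Proof.
intros Hc Hf%is_lim_seq_spec B.
destruct (Hf (c * IZR B)%R) as [N HN]; exists N; intros n Hn.
apply lt_IZR, (Rmult_lt_reg_l c); [exact Hc|now apply HN].
Qed.

Lemma tends_to_m_infty_Z (c : R) (f : nat -> Z) :
  (0 < c)%R -> is_lim_seq (fun n => c * IZR (f n))%R m_infty ->
  forall B, exists N, forall n, (N <= n)%nat -> f n < B.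
Proof.
intros Hc Hf B.
destruct (tends_to_p_infty_Z c (fun n => - f n) Hc) with (B := - B) as [N HN].
- apply is_lim_seq_opp in Hf.
  eapply is_lim_seq_ext; [|exact Hf].
  intros n; cbv beta; rewrite opp_IZR; ring.
- exists N; intros n Hn; specialize (HN n Hn); lia.
Qed.

Lemma center_x_abscissa (t : tile) : center_x t = (/ 2 * IZR (abscissa t))%R.
Proof. unfold center_x, abscissa; rewrite plus_IZR, mult_IZR; field. Qed.

Lemma row_height_pos : (0 < sqrt 3 / 2)%R.
Proof. assert (0 < sqrt 3)%R by (apply sqrt_lt_R0; lra); lra. Qed.

Lemma glide_pairing_blocks_Red (c : coloring) :
  (forall t, snd t <= 0 -> c t Red -> ~ c (glide t) Red) -> ~ wins Red c.
Proof.
intros Hpair [h [Hh [[Hfx Hfy] [Hbx Hby]]]].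
assert (Hhalf : (0 < / 2)%R) by lra.
apply (is_lim_seq_ext _ _ _ (fun n => center_x_abscissa _)) in Hfx, Hbx.
apply (glide_pairing_blocks (fun t => c t Red) h).
- intros n; apply Hh.
- intros n; apply Hh.
- intros B.
  destruct (tends_to_p_infty_Z _ _ Hhalf Hfx B) as [N1 H1].
  destruct (tends_to_p_infty_Z _ _ row_height_pos Hfy B) as [N2 H2].
  exists (Z.of_nat (Nat.max N1 N2)); intros n Hn; unfold forward_end in *.
  specialize (H1 (Z.to_nat n) ltac:(lia)); specialize (H2 (Z.to_nat n) ltac:(lia)).
  rewrite Z2Nat.id in H1, H2 by lia; tauto.
- intros B.
  destruct (tends_to_m_infty_Z _ _ Hhalf Hbx B) as [N1 H1].
  destruct (tends_to_m_infty_Z _ _ row_height_pos Hby B) as [N2 H2].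
  exists (- Z.of_nat (Nat.max N1 N2)); intros n Hn; unfold backward_end in *.
  specialize (H1 (Z.to_nat (- n)) ltac:(lia)); specialize (H2 (Z.to_nat (- n)) ltac:(lia)).
  rewrite Z2Nat.id, Z.opp_involutive in H1, H2 by lia; tauto.
- exact Hpair.
Qed.

(** * Exchanging the colours by reflection *)

(** Reflection in the axis [x = 0]. *)
Definition mirror (t : tile) : tile := (- fst t - snd t, snd t).

Lemma mirror_involutive (t : tile) : mirror (mirror t) = t.
Proof. apply injective_projections; unfold mirror; cbn [fst snd]; lia. Qed.

Lemma mirror_adjacent (t u : tile) : adjacent t u -> adjacent (mirror t) (mirror u).
Proof. rewrite !adjacent_coord; unfold mirror; cbn [fst snd]; lia. Qed.

Lemma tends_to_mirror (g : nat -> tile) (lx ly : Rbar) :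
  tends_to g lx ly -> tends_to (fun n => mirror (g n)) (Rbar_opp lx) ly.
Proof.
intros [Hx Hy]; split; [|exact Hy].
apply is_lim_seq_opp in Hx.
eapply is_lim_seq_ext; [|exact Hx].
intros n; unfold center_x, mirror; cbn [fst snd].
rewrite minus_IZR, opp_IZR; field.
Qed.

Lemma wins_mirror (c : coloring) :
  wins Blue c -> wins Red (fun t p => c (mirror t) (opponent p)).
Proof.
intros [h [Hh [Hf Hb]]]; exists (fun n => mirror (h n)); split; [|split].
- intros n; destruct (Hh n) as [Hc Ha]; split.
  + rewrite mirror_involutive; exact Hc.
  + now apply mirror_adjacent.
- exact (tends_to_mirror _ _ _ Hf).
- exact (tends_to_mirror _ _ _ Hb).
Qed.

(** * The pairings and the pairing strategy *)

Definition glide_partner (t : tile) : tile :=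
  if snd t <=? 0 then glide t else unglide t.

(** The pairing directed against the chains of [p]. *)
Definition partner (p : player) (t : tile) : tile :=
  match p with
  | Red => glide_partner t
  | Blue => mirror (glide_partner (mirror t))
  end.

Lemma glide_partner_involutive (t : tile) : glide_partner (glide_partner t) = t.
Proof.
apply injective_projections; unfold glide_partner, glide, unglide;
  destruct (Z.leb_spec (snd t) 0); cbn [fst snd];
  destruct (Z.leb_spec (1 - snd t) 0); cbn [fst snd]; lia.
Qed.

Lemma partner_involutive (p : player) (t : tile) : partner p (partner p t) = t.
Proof.
destruct p; simpl; [apply glide_partner_involutive|].
now rewrite mirror_involutive, glide_partner_involutive, mirror_involutive.
Qed.

(** In particular no tile is its own partner. *)
Lemma partner_row (p : player) (t : tile) : snd (partner p t) = 1 - snd t.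
Proof.
destruct p; simpl; unfold glide_partner, glide, unglide; simpl;
  now destruct (snd t <=? 0).
Qed.

Lemma partner_pairing_blocks (p : player) (c : coloring) :
  (forall t, c t p -> ~ c (partner p t) p) -> ~ wins p c.
Proof.
intros Hc Hwin.
assert (Hlow : forall t, snd t <= 0 -> glide_partner t = glide t).
{ intros t Ht; unfold glide_partner; now destruct (Z.leb_spec (snd t) 0); [|lia]. }
destruct p.
- revert Hwin; apply glide_pairing_blocks_Red; intros t Ht Hct.
  rewrite <- Hlow by exact Ht; now apply Hc.
- apply wins_mirror in Hwin; revert Hwin.
  apply glide_pairing_blocks_Red; simpl; intros t Ht Hct.
  rewrite <- Hlow, <- (mirror_involutive t) by exact Ht; now apply Hc.
Qed.

Definition fresh (l : list tile) : tile :=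
  (1 + fold_right (fun t B => Z.max (fst t) B) 0 l, 0).

Lemma fresh_not_in (l : list tile) : ~ In (fresh l) l.
Proof.
assert (H : forall t, In t l -> fst t <= fold_right (fun t B => Z.max (fst t) B) 0 l).
{ induction l as [|u l IH]; intros t; [intros []|].
  cbn [fold_right]; intros [<-|Ht]; [lia|specialize (IH t Ht); lia]. }
intros Hin; specialize (H _ Hin); unfold fresh in H; cbn [fst] in H; lia.
Qed.

(** Answers the last move with its partner. The default value [(0, 0)] makes an
    opening move, and a fresh tile replaces a partner that is already taken;
    both are extra stones, which never help the opponent. *)
Definition pairing_strategy (sigma : tile -> tile) (l : list tile) : tile :=
  let t := sigma (last l (0, 0)) in
  if in_dec tile_eq_dec t l then fresh l else t.

Lemma pairing_strategy_legal (sigma : tile -> tile) (l : list tile) :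
  ~ In (pairing_strategy sigma l) l.
Proof.
unfold pairing_strategy; destruct (in_dec tile_eq_dec _ l);
  [apply fresh_not_in|assumption].
Qed.

Lemma mover_succ (first : player) (n : nat) :
  mover first (S n) = opponent (mover first n).
Proof.
unfold mover; rewrite Nat.even_succ, <- Nat.negb_even.
now destruct (Nat.even n), first.
Qed.

Lemma history_succ (m : nat -> tile) (n : nat) :
  history m (S n) = history m n ++ [m n].
Proof. unfold history; now rewrite seq_S, map_app. Qed.

(** If the opponent took [t] at move [i] and its partner later, then the partner
    was still free at move [i + 1], where the strategy would have taken it. *)
Lemma pairing_strategy_separates (first p : player) (sigma : tile -> tile)
    (m : nat -> tile) :
  (forall t, sigma (sigma t) = t) -> (forall t, sigma t <> t) ->
  is_play m -> follows first p (pairing_strategy sigma) m ->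
  forall t, outcome first m t (opponent p) -> ~ outcome first m (sigma t) (opponent p).
Proof.
intros Hinv Hfix Hplay Hfollow.
assert (Hinj : forall i j, m i = m j -> i = j).
{ intros i j E; destruct (Nat.lt_trichotomy i j) as [H|[H|H]]; [|exact H|];
    now elim (Hplay _ _ H). }
assert (Hlate : forall i j, (i < j)%nat -> mover first i = opponent p ->
   mover first j = opponent p -> m j <> sigma (m i)).
{ intros i j Hij Hi Hj E.
  assert (Hturn : mover first (S i) = p)
    by (rewrite mover_succ, Hi; now destruct p).
  assert (Hreply : m (S i) = m j).
  { rewrite E, (Hfollow _ Hturn); unfold pairing_strategy.
    rewrite history_succ, last_last.
    destruct (in_dec tile_eq_dec _ _) as [Hin|]; [exfalso|reflexivity].
    rewrite <- history_succ, <- E in Hin.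
    apply in_map_iff in Hin; destruct Hin as [k [Ek Hk%in_seq]].
    apply Hinj in Ek; subst k.
    replace j with i in Hij by lia; lia. }
  apply Hinj in Hreply; subst j; rewrite Hturn in Hj; now destruct p. }
intros t [i [Hi Ei]] [j [Hj Ej]].
destruct (Nat.lt_trichotomy i j) as [H|[H|H]].
- apply (Hlate i j H Hi Hj); congruence.
- subst j; apply (Hfix t); congruence.
- apply (Hlate j i H Hj Hi); rewrite Ej, Hinv; exact Ei.
Qed.

Lemma drawing_strategy_exists (first p : player) :
  exists s, drawing_strategy first p s.
Proof.
exists (pairing_strategy (partner (opponent p))); split.
- intros l _ _; apply pairing_strategy_legal.
- intros m Hplay Hfollow; apply partner_pairing_blocks.
  apply pairing_strategy_separates; try assumption.
  + apply partner_involutive.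
  + intros t E; apply (f_equal snd) in E; rewrite partner_row in E; lia.
Qed.

(** * Playing one strategy against the other *)

Section JointPlay.

Variable choose : list tile -> tile.

Fixpoint joint_history (n : nat) : list tile :=
  match n with
  | O => []
  | S n' => joint_history n' ++ [choose (joint_history n')]
  end.

Definition joint_play (n : nat) : tile := choose (joint_history n).

Lemma history_joint_play (n : nat) : history joint_play n = joint_history n.
Proof.
induction n as [|n IH]; [reflexivity|].
now rewrite history_succ, IH.
Qed.

End JointPlay.

Lemma legal_joint_play (choose : list tile -> tile) :
  (forall l, NoDup l -> ~ In (choose l) l) -> is_play (joint_play choose).
Proof.
intros Hlegal.
assert (Hnd : forall n, NoDup (joint_history choose n)).
{ induction n as [|n IH]; simpl; [constructor|].
  apply NoDup_app; [exact IH|repeat constructor; intros []|].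
  intros t Ht [<-|[]]; now apply (Hlegal _ IH). }
intros i j Hij E; apply (Hlegal _ (Hnd j)).
change (In (joint_play choose j) (joint_history choose j)).
rewrite <- E, <- history_joint_play.
apply in_map, in_seq; lia.
Qed.

Lemma strategies_joint_play (first p : player) (s s' : list tile -> tile) :
  is_strategy first p s -> is_strategy first (opponent p) s' ->
  exists m, is_play m /\ follows first p s m /\ follows first (opponent p) s' m.
Proof.
intros Hs Hs'.
assert (Hdec : forall q : player, {q = p} + {q = opponent p})
  by (intros [] ; destruct p; simpl; auto).
pose (choose := fun l : list tile =>
  if Hdec (mover first (length l)) then s l else s' l).
assert (Hlen : forall n, length (history (joint_play choose) n) = n)
  by (intros n; unfold history; now rewrite length_map, length_seq).
exists (joint_play choose); split; [|split].
- apply legal_joint_play; intros l Hl; unfold choose.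
  destruct (Hdec _) as [E|E]; [now apply Hs|now apply Hs'].
- intros n Hn; unfold joint_play; rewrite <- history_joint_play.
  unfold choose at 1; rewrite Hlen.
  destruct (Hdec _) as [E|E]; [reflexivity|rewrite Hn in E; now destruct p].
- intros n Hn; unfold joint_play; rewrite <- history_joint_play.
  unfold choose at 1; rewrite Hlen.
  destruct (Hdec _) as [E|E]; [rewrite Hn in E; now destruct p|reflexivity].
Qed.

Theorem theorem6 (first : player) :
  (forall p : player,
     ~ exists s : list tile -> tile, winning_strategy first p s) /\
  (forall p : player,
     exists s : list tile -> tile, drawing_strategy first p s).
Proof.
split; intros p; [|apply drawing_strategy_exists].
intros [s [Hs Hwin]].
destruct (drawing_strategy_exists first (opponent p)) as [s' [Hs' Hdraw]].
destruct (strategies_joint_play first p s s' Hs Hs') as [m [Hm [Hf Hf']]].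
apply (Hdraw m Hm Hf').
replace (opponent (opponent p)) with p by now destruct p.
now apply Hwin.
Qed.
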